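(* Let $u(x,t)=p_1(t)e^{-|x-q_1(t)|}+p_2(t)e^{-|x-q_2(t)|}$ be a twopeakon solution to the Camassa--Holm equation with initial data $(q(0),p(0))$ satisfying $q(0)\in\Omega=\{(q_1,q_2)\in\mathbb{R}^2 : q_1>q_2\}$. Then the twopeakon collides in a finite time if and only if $$p_2(0)>0>p_1(0).$$
   Context: The Camassa--Holm equation is $u_t-u_{xxt}+3uu_x-2u_xu_{xx}-uu_{xxx}=0$. A twopeakon solution is a function $u(x,t)=\sum_{i=1}^2 p_i(t)e^{-|x-q_i(t)|}$ where $q=(q_1,q_2)$, $p=(p_1,p_2)$ solve the Hamiltonian system $\dot q_i=\partial H/\partial p_i$, $\dot p_i=-\partial H/\partial q_i$, $i=1,2$, with $H(q,p)=\frac12\sum_{i,j=1}^2 p_ip_je^{-|q_i-q_j|}$. With $q(0)\in\Omega$, the solution is the maximal forward solution of this system with $q(t)\in\Omega$. The twopeakon collides at a (finite) time $t^*>0$ if the solution exists with $q(t)\in\Omega$ on $[0,t^* )$, $q$ extends continuously to $t^*$, and $q_1(t^* )=q_2(t^* )$; it collides in a finite time if such a $t^*$ exists. *)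

(* Defs.v *)
From Stdlib Require Import Reals.
From Coquelicot Require Import Coquelicot.
Open Scope R_scope.

(** Points of the plane are pairs [(q_1, q_2) : R * R]. *)
Definition Omega (q : R * R) : Prop := fst q > snd q.

(** The double sum over [i, j = 1, 2], written out. *)
Definition H (q p : R * R) : R :=
  / 2 * (fst p * fst p * exp (- Rabs (fst q - fst q))
       + fst p * snd p * exp (- Rabs (fst q - snd q))
       + snd p * fst p * exp (- Rabs (snd q - fst q))
       + snd p * snd p * exp (- Rabs (snd q - snd q))).

(** [H] is differentiable in each variable wherever [q] lies in [Omega], the
    only place where these are used, so the default value of [Derive] plays no
    role. *)
Definition dH_dq1 (q p : R * R) : R := Derive (fun y => H (y, snd q) p) (fst q).
Definition dH_dq2 (q p : R * R) : R := Derive (fun y => H (fst q, y) p) (snd q).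
Definition dH_dp1 (q p : R * R) : R := Derive (fun y => H q (y, snd p)) (fst p).
Definition dH_dp2 (q p : R * R) : R := Derive (fun y => H q (fst p, y)) (snd p).

(** The interval [[0, T)], where [T] may be [p_infty]. *)
Definition time_interval (T : Rbar) (t : R) : Prop := 0 <= t /\ Rbar_lt t T.

(** [D_in] is the derivative relative to [[0, T)]: one-sided at [0], the usual
    derivative at interior times. Values of [q] and [p] outside [[0, T)] are
    irrelevant. *)
Definition is_solution (T : Rbar) (q p : R -> R * R) : Prop :=
  Rbar_lt 0 T /\
  forall t : R, time_interval T t ->
    Omega (q t) /\
    D_in (fun s => fst (q s)) (fun s => dH_dp1 (q s) (p s)) (time_interval T) t /\
    D_in (fun s => snd (q s)) (fun s => dH_dp2 (q s) (p s)) (time_interval T) t /\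
    D_in (fun s => fst (p s)) (fun s => - dH_dq1 (q s) (p s)) (time_interval T) t /\
    D_in (fun s => snd (p s)) (fun s => - dH_dq2 (q s) (p s)) (time_interval T) t.

Definition is_maximal_solution (T : Rbar) (q p : R -> R * R) : Prop :=
  is_solution T q p /\
  forall (T' : Rbar) (q' p' : R -> R * R),
    is_solution T' q' p' ->
    (forall t : R, time_interval T t -> q' t = q t /\ p' t = p t) ->
    Rbar_le T' T.

Definition is_twopeakon (T : Rbar) (q p : R -> R * R) (u : R -> R -> R) : Prop :=
  is_maximal_solution T q p /\
  forall x t : R, time_interval T t ->
    u x t = fst (p t) * exp (- Rabs (x - fst (q t)))
          + snd (p t) * exp (- Rabs (x - snd (q t))).

(** For a solution [(q, p)] on [[0, T)]; the continuous extension of [q] to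
    time [t] is its (finite) left limit [l], and need not be the value [q t]. *)
Definition collides_at (T : Rbar) (q : R -> R * R) (t : R) : Prop :=
  0 < t /\ Rbar_le t T /\
  exists l : R * R, filterlim q (at_left t) (locally l) /\ fst l = snd l.

Definition collides_in_finite_time (T : Rbar) (q : R -> R * R) : Prop :=
  exists t : R, collides_at T q t.

(* Main.v *)
Require Import Defs.
From Stdlib Require Import Reals Lra Ranalysis5.
From Coquelicot Require Import Coquelicot.
Open Scope R_scope.

(** Write [E = exp (q2 - q1)], which lies in (0, 1) on [Omega]. The system reads
    [q1' = p1 + p2 E], [q2' = p2 + p1 E], [p1' = p1 p2 E = - p2'], and has two
    first integrals: the momentum [P = p1 + p2] and, since
    [H = P^2 / 2 - p1 p2 (1 - E)], the interaction [K = p1 p2 (1 - E)]. The gap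
    [w = q1 - q2] satisfies [w' = (p1 - p2) (1 - E)], so it can only shrink quickly
    if [p1 - p2] becomes very negative.

    If [p1 < 0 < p2] fails initially, [p1 - p2] stays above [- |P|]: either
    [K >= 0], so that [p1 p2 >= 0] for all times and [|p1 - p2| <= |P|], or
    [p1 > 0 > p2] initially, and [p1 - p2] can never vanish because [p1 p2 < 0] is
    kept ([momentum_gap_bounded_below]). As [0 < 1 - E <= w], Gronwall gives
    [w t >= w 0 * exp (- |P| t)], which forbids a collision ([gap_lower_bound],
    [no_collision]).

    If [p1 < 0 < p2] initially, then [K < 0] and the system can be integrated.
    Put [m = sqrt (P^2 - 4 K)], which exceeds [|P|], and [d = p1 - p2]. Then
    [d^2 = P^2 - 4 p1 p2 = P^2 - 4 K / (1 - E)] forces [d < - m], and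
    eliminating [E] from [d' = 2 p1 p2 E] leaves the Riccati equation
    [d' = (m^2 - d^2) / 2]. Its Moebius transform [y = (d + m) / (d - m)] solves
    [y' = m y], so [y] grows exponentially from a value in (0, 1) and reaches 1,
    that is [d = - oo], at an explicit time. Momenta and positions are elementary
    functions of [y] and time ([flow_closed_form]). The closed form solves the
    system until [y = 1] ([closed_form_flow]), so a maximal solution lives at least
    that long; and although the momenta blow up, the positions stay continuous
    there and coincide ([peaks_continuous], [peaks_meet]). Having the solution
    explicitly replaces a local existence theorem in the use of maximality. *)

(** * Calculus on [[0, T)] *)

Lemma time_interval_le (T : Rbar) (s t : R) :
  0 <= s <= t -> time_interval T t -> time_interval T s.
Proof.
  intros Hs [_ Ht]. split; [lra|].
  apply (Rbar_le_lt_trans s t T); [exact (proj2 Hs)|exact Ht].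
Qed.

Lemma Rbar_lt_open (T : Rbar) (t : R) :
  Rbar_lt t T -> exists del, 0 < del /\ forall x, x < t + del -> Rbar_lt x T.
Proof.
  destruct T as [T| |]; simpl; intros Ht.
  - exists (T - t). split; [lra|]. intros; lra.
  - exists 1. split; [lra|]. intros; exact I.
  - contradiction.
Qed.

(** Prolonging a function linearly to negative times, with slope its one-sided
    derivative at 0, turns derivatives relative to [[0, T)] into two-sided ones, so
    that the usual differential calculus applies at 0 as well. *)
Definition extend (f : R -> R) (v x : R) : R :=
  if Rlt_dec x 0 then f 0 + v * x else f x.

Lemma extend_eq (f : R -> R) (v x : R) : 0 <= x -> extend f v x = f x.
Proof. intros Hx. unfold extend. destruct (Rlt_dec x 0); [lra|reflexivity]. Qed.

Lemma is_derive_extend (T : Rbar) (f d : R -> R) (t : R) :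
  time_interval T t -> D_in f d (time_interval T) t ->
  is_derive (extend f (d 0)) t (d t).
Proof.
  intros [Ht0 HtT] HD. apply is_derive_Reals. intros eps Heps.
  destruct (HD eps Heps) as [alp [Halp HD']]. simpl in HD'. unfold Rdist in HD'.
  destruct (Rbar_lt_open T t HtT) as [del [Hdel HT]].
  (* at [t > 0] the radius must keep [t + h] nonnegative; at [t = 0] a negative
     [h] lands in the linear part, where the difference quotient is exact *)
  set (r := if Rlt_dec 0 t then t else 1).
  assert (Hr : 0 < r) by (unfold r; destruct (Rlt_dec 0 t); lra).
  assert (Hm : 0 < Rmin r (Rmin alp del)) by (repeat apply Rmin_pos; assumption).
  exists (mkposreal _ Hm). simpl. intros h Hh Hlt.
  pose proof (Rmin_l r (Rmin alp del)). pose proof (Rmin_r r (Rmin alp del)).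
  pose proof (Rmin_l alp del). pose proof (Rmin_r alp del).
  rewrite (extend_eq f (d 0) t Ht0).
  unfold extend. destruct (Rlt_dec (t + h) 0) as [Hn|Hn].
  - assert (t = 0) as ->.
    { unfold r in *. destruct (Rlt_dec 0 t); [|lra].
      apply Rabs_lt_between in Hlt. lra. }
    replace ((f 0 + d 0 * (0 + h) - f 0) / h - d 0) with 0 by (field; exact Hh).
    rewrite Rabs_R0. exact Heps.
  - specialize (HD' (t + h)).
    replace (t + h - t) with h in HD' by ring. apply HD'.
    apply Rabs_lt_between in Hlt as Hlt'.
    repeat split; try lra. apply HT. lra.
Qed.

Lemma is_derive_D_in (D : R -> Prop) (f d : R -> R) (t : R) :
  is_derive f t (d t) -> D_in f d D t.
Proof.
  intros Hf. apply is_derive_Reals in Hf.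
  intros eps Heps. destruct (Hf eps Heps) as [del Hdel].
  exists del. split; [apply cond_pos|]. simpl. unfold Rdist.
  intros x [[_ Hne] Hx].
  specialize (Hdel (x - t)). replace (t + (x - t)) with x in Hdel by ring.
  apply Hdel; [lra|exact Hx].
Qed.

Lemma is_derive_continuity_pt (f : R -> R) (t l : R) :
  is_derive f t l -> continuity_pt f t.
Proof.
  intros Hf. apply derivable_continuous_pt. exists l.
  apply is_derive_Reals. exact Hf.
Qed.

Lemma nondecreasing_from_0 (T : Rbar) (f d : R -> R) :
  (forall t, time_interval T t -> is_derive f t (d t) /\ 0 <= d t) ->
  forall t, time_interval T t -> f 0 <= f t.
Proof.
  intros Hf t Ht.
  assert (Hsub : forall s, Rmin 0 t <= s <= Rmax 0 t -> time_interval T s).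
  { intros s Hs. rewrite Rmin_left, Rmax_right in Hs by apply Ht.
    exact (time_interval_le T s t Hs Ht). }
  destruct (MVT_gen f 0 t d) as [c [Hc Heq]].
  - intros s Hs. apply Hf, Hsub. lra.
  - intros s Hs. apply (is_derive_continuity_pt f s (d s)), Hf, Hsub, Hs.
  - assert (Hd : 0 <= d c) by apply Hf, Hsub, Hc.
    pose proof (Rmult_le_pos (d c) (t - 0) Hd). destruct Ht. lra.
Qed.

Lemma constant_from_0 (T : Rbar) (f : R -> R) :
  (forall t, time_interval T t -> is_derive f t 0) ->
  forall t, time_interval T t -> f t = f 0.
Proof.
  intros Hf t Ht. apply Rle_antisym.
  - apply Ropp_le_cancel.
    apply (nondecreasing_from_0 T (fun s => - f s) (fun _ => 0)); [|exact Ht].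
    intros s Hs. split; [|lra].
    rewrite <- Ropp_0. exact (is_derive_opp f s 0 (Hf s Hs)).
  - apply (nondecreasing_from_0 T f (fun _ => 0)); [|exact Ht].
    intros s Hs. split; [apply Hf, Hs|lra].
Qed.

(** By the intermediate value theorem a nonvanishing function keeps its sign. *)
Lemma positive_from_0 (T : Rbar) (f d : R -> R) :
  (forall t, time_interval T t -> is_derive f t (d t) /\ f t <> 0) ->
  0 < f 0 -> forall t, time_interval T t -> 0 < f t.
Proof.
  intros Hf H0 t Ht. destruct (Rlt_le_dec 0 (f t)) as [|Hle]; [assumption|].
  destruct (Rle_lt_or_eq_dec _ _ Hle) as [Hlt|Heq].
  2: { exfalso. exact (proj2 (Hf t Ht) Heq). }
  assert (Ht0 : 0 < t).
  { destruct Ht as [[|<-] _]; [assumption|lra]. }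
  destruct (IVT_interv (fun s => - f s) 0 t) as [z [Hz Hfz]]; try lra.
  - intros s Hs. apply continuity_pt_opp.
    apply (is_derive_continuity_pt f s (d s)), Hf, (time_interval_le T s t Hs Ht).
  - exfalso. apply (proj2 (Hf z (time_interval_le T z t Hz Ht))). lra.
Qed.

(** * The equations of motion *)

(** The Hamiltonian system with its partial derivatives computed, for functions
    defined around 0 so that all derivatives are two-sided. *)
Definition flow (T : Rbar) (q1 q2 p1 p2 : R -> R) : Prop :=
  forall t, time_interval T t ->
    q2 t < q1 t /\
    is_derive q1 t (p1 t + p2 t * exp (q2 t - q1 t)) /\
    is_derive q2 t (p2 t + p1 t * exp (q2 t - q1 t)) /\
    is_derive p1 t (p1 t * p2 t * exp (q2 t - q1 t)) /\
    is_derive p2 t (- (p1 t * p2 t * exp (q2 t - q1 t))).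

(** The diagonal terms of [H] contain [Rabs (y - y)], a constant to which the
    differentiation rule for [Rabs] does not apply, and the others are smooth only
    off the diagonal; on the open set [Omega] both absolute values disappear. *)
Lemma H_Omega (q p : R * R) : Omega q ->
  H q p = / 2 * (fst p * fst p + snd p * snd p) + fst p * snd p * exp (snd q - fst q).
Proof.
  unfold Omega, H. intros Hq.
  rewrite !Rminus_diag, Rabs_R0, Ropp_0, exp_0.
  rewrite (Rabs_right (fst q - snd q)) by lra.
  rewrite (Rabs_left (snd q - fst q)) by lra.
  replace (- (fst q - snd q)) with (snd q - fst q) by ring.
  rewrite Ropp_involutive. field.
Qed.

Lemma partials_of_H (q p : R * R) : Omega q ->
  dH_dp1 q p = fst p + snd p * exp (snd q - fst q) /\
  dH_dp2 q p = snd p + fst p * exp (snd q - fst q) /\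
  dH_dq1 q p = - (fst p * snd p * exp (snd q - fst q)) /\
  dH_dq2 q p = fst p * snd p * exp (snd q - fst q).
Proof.
  intros Hq. pose proof Hq as Hq'. unfold Omega in Hq'.
  repeat split; apply is_derive_unique.
  - eapply is_derive_ext; [intros y; symmetry; apply H_Omega, Hq|].
    simpl. auto_derive; [trivial|]. field.
  - eapply is_derive_ext; [intros y; symmetry; apply H_Omega, Hq|].
    simpl. auto_derive; [trivial|]. field.
  - eapply is_derive_ext_loc.
    { apply (filter_imp (fun y => snd q < y)).
      - intros y Hy. symmetry. apply H_Omega. unfold Omega; simpl. lra.
      - apply open_gt. lra. }
    simpl. auto_derive; [trivial|]. unfold Rminus. ring.
  - eapply is_derive_ext_loc.
    { apply (filter_imp (fun y => y < fst q)).
      - intros y Hy. symmetry. apply H_Omega. unfold Omega; simpl. lra.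
      - apply open_lt. lra. }
    simpl. auto_derive; [trivial|]. unfold Rminus. ring.
Qed.

Lemma flow_of_solution (T : Rbar) (q p : R -> R * R) :
  is_solution T q p ->
  exists q1 q2 p1 p2 : R -> R,
    flow T q1 q2 p1 p2 /\
    forall t, 0 <= t -> q t = (q1 t, q2 t) /\ p t = (p1 t, p2 t).
Proof.
  intros [_ Hsol].
  exists (extend (fun s => fst (q s)) (dH_dp1 (q 0) (p 0))),
         (extend (fun s => snd (q s)) (dH_dp2 (q 0) (p 0))),
         (extend (fun s => fst (p s)) (- dH_dq1 (q 0) (p 0))),
         (extend (fun s => snd (p s)) (- dH_dq2 (q 0) (p 0))).
  split.
  - intros t Ht. rewrite !extend_eq by apply Ht.
    destruct (Hsol t Ht) as [HO [H1 [H2 [H3 H4]]]].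
    destruct (partials_of_H (q t) (p t) HO) as [E1 [E2 [E3 E4]]].
    apply (is_derive_extend _ _ _ _ Ht) in H1.
    apply (is_derive_extend _ _ _ _ Ht) in H2.
    apply (is_derive_extend _ _ _ _ Ht) in H3.
    apply (is_derive_extend _ _ _ _ Ht) in H4.
    cbv beta in H1, H2, H3, H4.
    rewrite E1 in H1. rewrite E2 in H2. rewrite E3, Ropp_involutive in H3.
    rewrite E4 in H4. exact (conj HO (conj H1 (conj H2 (conj H3 H4)))).
  - intros t Ht. rewrite !extend_eq by exact Ht. split; apply surjective_pairing.
Qed.

Lemma solution_of_flow (T : Rbar) (q1 q2 p1 p2 : R -> R) :
  Rbar_lt 0 T -> flow T q1 q2 p1 p2 ->
  is_solution T (fun t => (q1 t, q2 t)) (fun t => (p1 t, p2 t)).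
Proof.
  intros HT Hf. split; [exact HT|]. intros t Ht.
  destruct (Hf t Ht) as [HO [H1 [H2 [H3 H4]]]].
  destruct (partials_of_H (q1 t, q2 t) (p1 t, p2 t) HO) as [E1 [E2 [E3 E4]]].
  simpl in *.
  split; [exact HO|].
  repeat split; apply is_derive_D_in; simpl.
  - rewrite E1. exact H1.
  - rewrite E2. exact H2.
  - rewrite E3, Ropp_involutive. exact H3.
  - rewrite E4. exact H4.
Qed.

(** * First integrals *)

Lemma momentum_conserved (T : Rbar) (q1 q2 p1 p2 : R -> R) :
  flow T q1 q2 p1 p2 ->
  forall t, time_interval T t -> p1 t + p2 t = p1 0 + p2 0.
Proof.
  intros Hf. apply (constant_from_0 T (fun t => p1 t + p2 t)). intros t Ht.
  destruct (Hf t Ht) as [_ [_ [_ [H3 H4]]]].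
  pose proof (is_derive_plus _ _ _ _ _ H3 H4) as Hs.
  unfold plus in Hs; simpl in Hs. rewrite Rplus_opp_r in Hs. exact Hs.
Qed.

(** Up to the constant [(p1 + p2)^2 / 2], the opposite of the energy [H]. *)
Definition interaction (q1 q2 p1 p2 : R -> R) (t : R) : R :=
  p1 t * p2 t * (1 - exp (q2 t - q1 t)).

Lemma interaction_conserved (T : Rbar) (q1 q2 p1 p2 : R -> R) :
  flow T q1 q2 p1 p2 ->
  forall t, time_interval T t ->
    interaction q1 q2 p1 p2 t = interaction q1 q2 p1 p2 0.
Proof.
  intros Hf. apply (constant_from_0 T (interaction q1 q2 p1 p2)). intros t Ht.
  destruct (Hf t Ht) as [_ [H1 [H2 [H3 H4]]]]. unfold interaction.
  auto_derive.
  - repeat split; eexists; eassumption.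
  - apply is_derive_unique in H1; apply is_derive_unique in H2;
    apply is_derive_unique in H3; apply is_derive_unique in H4.
    change (Derive (fun x => q1 x) t) with (Derive q1 t).
    change (Derive (fun x => q2 x) t) with (Derive q2 t).
    change (Derive (fun x => p1 x) t) with (Derive p1 t).
    change (Derive (fun x => p2 x) t) with (Derive p2 t).
    rewrite H1, H2, H3, H4. unfold Rminus. ring.
Qed.

Lemma exp_gap_bounds (x y : R) : y < x -> 0 < exp (y - x) < 1.
Proof.
  intros Hxy. split; [apply exp_pos|]. rewrite <- exp_0. apply exp_increasing. lra.
Qed.

(** * No collision without opposite momenta *)

(** The sign of the conserved [p1 p2 (1 - E)] is that of [p1 p2]. If it is
    nonnegative, [(p1 - p2)^2 = P^2 - 4 p1 p2 <= P^2]; if it is negative, the same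
    identity shows that [p1 - p2] never vanishes, hence stays positive. *)
Lemma momentum_gap_bounded_below (T : Rbar) (q1 q2 p1 p2 : R -> R) :
  flow T q1 q2 p1 p2 -> ~ (p2 0 > 0 /\ 0 > p1 0) ->
  forall t, time_interval T t -> - Rabs (p1 0 + p2 0) <= p1 t - p2 t.
Proof.
  intros Hf Hsign t Ht.
  assert (I0 : time_interval T 0) by (apply (time_interval_le T 0 t); [destruct Ht; lra|exact Ht]).
  pose proof (proj1 (Hf 0 I0)) as HO0. apply exp_gap_bounds in HO0.
  pose proof (Rabs_pos (p1 0 + p2 0)) as Habs.
  destruct (Rle_lt_dec 0 (p1 0 * p2 0)) as [Hpos|Hneg].
  - pose proof (interaction_conserved T _ _ _ _ Hf t Ht) as HK. unfold interaction in HK.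
    pose proof (exp_gap_bounds _ _ (proj1 (Hf t Ht))) as HE.
    assert (Hp : 0 <= p1 t * p2 t).
    { destruct (Rle_lt_dec 0 (p1 t * p2 t)); [assumption|]. nra. }
    pose proof (momentum_conserved T _ _ _ _ Hf t Ht) as HP.
    assert (Hsq : Rsqr (p1 t - p2 t) <= Rsqr (p1 0 + p2 0)).
    { rewrite <- HP. unfold Rsqr. nra. }
    apply Rsqr_le_abs_0 in Hsq.
    pose proof (Rabs_maj2 (p1 t - p2 t)). lra.
  - assert (Hd : 0 < p1 t - p2 t); [|lra].
    apply (positive_from_0 T (fun s => p1 s - p2 s)
      (fun s => p1 s * p2 s * exp (q2 s - q1 s) - - (p1 s * p2 s * exp (q2 s - q1 s)))).
    + intros s Hs. split.
      * apply (is_derive_minus p1 p2); apply Hf, Hs.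
      * pose proof (interaction_conserved T _ _ _ _ Hf s Hs) as HK. unfold interaction in HK.
        pose proof (exp_gap_bounds _ _ (proj1 (Hf s Hs))) as HE.
        intros Heq. assert (0 <= p1 s * p2 s) by nra. nra.
    + destruct (Rle_lt_dec (p1 0) (p2 0)); [|lra].
      exfalso. apply Hsign. split; nra.
    + exact Ht.
Qed.

(** Gronwall: with [C = |P|], the gap [w] satisfies
    [w' = (p1 - p2) (1 - E) >= - C w], because [1 - E <= w]; so [w * exp (C t)]
    is nondecreasing. *)
Lemma gap_lower_bound (T : Rbar) (q1 q2 p1 p2 : R -> R) :
  flow T q1 q2 p1 p2 -> ~ (p2 0 > 0 /\ 0 > p1 0) ->
  forall t, time_interval T t ->
    (q1 0 - q2 0) * exp (- (Rabs (p1 0 + p2 0) * t)) <= q1 t - q2 t.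
Proof.
  intros Hf Hsign t Ht. set (C := Rabs (p1 0 + p2 0)).
  assert (Hmono : (q1 0 - q2 0) * exp (C * 0) <= (q1 t - q2 t) * exp (C * t)).
  { apply (nondecreasing_from_0 T (fun s => (q1 s - q2 s) * exp (C * s))
      (fun s => ((p1 s - p2 s) * (1 - exp (q2 s - q1 s)) + C * (q1 s - q2 s)) * exp (C * s)));
      [|exact Ht].
    intros s Hs. destruct (Hf s Hs) as [HO [H1 [H2 _]]]. split.
    - auto_derive.
      + repeat split; eexists; eassumption.
      + apply is_derive_unique in H1; apply is_derive_unique in H2.
        change (Derive (fun x => q1 x) s) with (Derive q1 s).
        change (Derive (fun x => q2 x) s) with (Derive q2 s).
        rewrite H1, H2. ring.
    - apply Rmult_le_pos; [|left; apply exp_pos].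
      pose proof (momentum_gap_bounded_below T _ _ _ _ Hf Hsign s Hs) as Hd. fold C in Hd.
      pose proof (exp_ineq1_le (q2 s - q1 s)) as Hexp.
      pose proof (exp_gap_bounds _ _ HO) as HE.
      assert (0 <= C) by apply Rabs_pos. nra. }
  rewrite Rmult_0_r, exp_0, Rmult_1_r in Hmono.
  rewrite exp_Ropp. apply Rmult_le_reg_r with (exp (C * t)); [apply exp_pos|].
  rewrite Rmult_assoc, Rinv_l, Rmult_1_r; [exact Hmono|].
  apply Rgt_not_eq, exp_pos.
Qed.

Lemma no_collision (T : Rbar) (q1 q2 p1 p2 : R -> R) (q : R -> R * R) :
  flow T q1 q2 p1 p2 -> (forall t, 0 <= t -> q t = (q1 t, q2 t)) ->
  ~ (p2 0 > 0 /\ 0 > p1 0) -> ~ collides_in_finite_time T q.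
Proof.
  intros Hf Hq Hsign [t [Ht [HtT [l [Hlim Hl]]]]].
  set (C := Rabs (p1 0 + p2 0)).
  assert (HI : forall s, 0 <= s < t -> time_interval T s).
  { intros s Hs. split; [lra|]. apply (Rbar_lt_le_trans s t T); [exact (proj2 Hs)|exact HtT]. }
  set (c := (q1 0 - q2 0) * exp (- (C * t))).
  assert (Hc : 0 < c).
  { apply Rmult_lt_0_compat; [|apply exp_pos].
    pose proof (proj1 (Hf 0 (HI 0 ltac:(lra)))). lra. }
  (* both peaks within [c / 2] of the same limit would be less than [c] apart *)
  assert (Hc2 : 0 < c / 2) by lra.
  pose proof (proj1 (filterlim_locally q l) Hlim (mkposreal _ Hc2)) as Hball.
  assert (Hpos : at_left t (fun s => 0 < s < t)).
  { unfold at_left, within. apply (filter_imp (fun s => 0 < s)); [intros; lra|].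
    apply open_gt. exact Ht. }
  destruct (filter_ex _ (filter_and _ _ Hball Hpos)) as [s [[B1 B2] Hs]].
  rewrite Hq in B1, B2 by lra. simpl in B1, B2.
  apply Rabs_lt_between in B1. apply Rabs_lt_between in B2.
  unfold minus, plus, opp in B1, B2; simpl in B1, B2.
  pose proof (gap_lower_bound T _ _ _ _ Hf Hsign s (HI s ltac:(lra))) as Hgap.
  fold C in Hgap.
  assert (Hcs : c <= (q1 0 - q2 0) * exp (- (C * s))).
  { apply Rmult_le_compat_l.
    - pose proof (proj1 (Hf 0 (HI 0 ltac:(lra)))). lra.
    - assert (HCs : - (C * t) <= - (C * s)).
      { assert (0 <= C) by apply Rabs_pos. nra. }
      destruct HCs as [HCs|HCs]; [left; apply exp_increasing, HCs|rewrite HCs; lra]. }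
  lra.
Qed.

(** * The colliding solutions in closed form *)

(** The parameters are [a = m + P] and [b = m - P], hence [m = (a + b) / 2] and
    [K = - a b / 4]. The function [ratio] is [y = (d + m) / (d - m)]. Solving for
    [d = - m (1 + y) / (1 - y)] and [p1, p2 = (P +- d) / 2] gives the momenta, and
    [E = 1 - K / (p1 p2) = (a + b)^2 y / ((a + b y) (b + a y))]. For the
    positions, [q1 - ln (- p1)] and [q2 + ln p2] have derivatives [p1] and [p2],
    whose primitives are elementary in [y] and time. *)
Section ClosedForm.
Variables (a b y0 c1 c2 : R).
Hypotheses (Ha : 0 < a) (Hb : 0 < b) (Hy0 : 0 < y0 < 1).

Definition ratio (t : R) : R := y0 * exp ((a + b) / 2 * t).
Definition peak1 (t : R) : R := c1 + ln (b + a * ratio t) - b / 2 * t.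
Definition peak2 (t : R) : R := c2 - ln (a + b * ratio t) + a / 2 * t.
Definition mom1 (t : R) : R := - ((b + a * ratio t) / (2 * (1 - ratio t))).
Definition mom2 (t : R) : R := (a + b * ratio t) / (2 * (1 - ratio t)).
Definition collision_time : R := - ln y0 / ((a + b) / 2).

Lemma ratio_pos (t : R) : 0 < ratio t.
Proof. apply Rmult_lt_0_compat; [lra|apply exp_pos]. Qed.

Lemma ratio_eq_exp (t : R) : ratio t = exp ((a + b) / 2 * (t - collision_time)).
Proof.
  unfold ratio, collision_time. rewrite <- (exp_ln y0) at 1 by lra.
  rewrite <- exp_plus. f_equal. field. lra.
Qed.

Lemma ratio_lt_1 (t : R) : ratio t < 1 <-> t < collision_time.
Proof.
  rewrite ratio_eq_exp, <- exp_0. split; intros Ht.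
  - apply exp_lt_inv in Ht. nra.
  - apply exp_increasing. nra.
Qed.

Lemma ratio_collision_time : ratio collision_time = 1.
Proof. rewrite ratio_eq_exp, Rminus_diag, Rmult_0_r. apply exp_0. Qed.

Lemma collision_time_pos : 0 < collision_time.
Proof. apply ratio_lt_1. unfold ratio. rewrite Rmult_0_r, exp_0. lra. Qed.

Lemma is_derive_ratio (t : R) : is_derive ratio t ((a + b) / 2 * ratio t).
Proof. unfold ratio. auto_derive; [trivial|]. ring. Qed.

(** The integration constants of the positions are tied together by the value of
    [E] at time 0. *)
Hypothesis Hgap : exp (c2 - c1) = (a + b) ^ 2 * y0.

Lemma exp_peak_gap (t : R) :
  exp (peak2 t - peak1 t)
  = (a + b) ^ 2 * ratio t / ((a + b * ratio t) * (b + a * ratio t)).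
Proof.
  pose proof (ratio_pos t) as Hy.
  unfold peak1, peak2.
  replace (c2 - ln (a + b * ratio t) + a / 2 * t - (c1 + ln (b + a * ratio t) - b / 2 * t))
    with ((c2 - c1) + (a + b) / 2 * t + - ln (a + b * ratio t) + - ln (b + a * ratio t)) by field.
  rewrite !exp_plus, !exp_Ropp, !exp_ln, Hgap by nra.
  unfold ratio at 3. field. split; nra.
Qed.

(** The peaks are ordered before the collision time because
    [1 - E = a b (1 - y)^2 / ((a + b y) (b + a y))]. *)
Lemma closed_form_flow : flow (Finite collision_time) peak1 peak2 mom1 mom2.
Proof.
  intros t [_ Ht]. simpl in Ht.
  pose proof (ratio_pos t) as Hy. apply ratio_lt_1 in Ht.
  pose proof (is_derive_ratio t) as HD. apply is_derive_unique in HD as HD'.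
  assert (Hex : ex_derive ratio t) by (eexists; exact HD).
  assert (N1 : 0 < a + b * ratio t) by nra. assert (N2 : 0 < b + a * ratio t) by nra.
  pose proof (exp_peak_gap t) as HE.
  split; [|rewrite HE; unfold peak1, peak2, mom1, mom2; split; [|split; [|split]]].
  - assert (Hlt : exp (peak2 t - peak1 t) < exp 0).
    { rewrite HE, exp_0. apply Rlt_div_l; [nra|].
      assert (0 < a * b * ((1 - ratio t) * (1 - ratio t))) by
        (repeat apply Rmult_lt_0_compat; lra).
      lra. }
    apply exp_lt_inv in Hlt. lra.
  - auto_derive; [repeat split; auto|].
    change (Derive (fun x => ratio x) t) with (Derive ratio t). rewrite HD'. field. lra.
  - auto_derive; [repeat split; auto|].
    change (Derive (fun x => ratio x) t) with (Derive ratio t). rewrite HD'. field. lra.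
  - auto_derive; [repeat split; auto; lra|].
    change (Derive (fun x => ratio x) t) with (Derive ratio t). rewrite HD'. field. lra.
  - auto_derive; [repeat split; auto; lra|].
    change (Derive (fun x => ratio x) t) with (Derive ratio t). rewrite HD'. field. lra.
Qed.

Lemma peaks_meet : peak1 collision_time = peak2 collision_time.
Proof.
  pose proof (exp_peak_gap collision_time) as HE. rewrite ratio_collision_time in HE.
  replace ((a + b) ^ 2 * 1 / ((a + b * 1) * (b + a * 1))) with (exp 0) in HE
    by (rewrite exp_0; field; lra).
  apply exp_inv in HE. lra.
Qed.

(** The poles of the momenta at [y = 1] cancel in the velocities: the positions
    involve only [ln (a + b y)] and [ln (b + a y)], smooth for all times. *)
Lemma peaks_continuous (t : R) : continuous peak1 t /\ continuous peak2 t.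
Proof.
  pose proof (ratio_pos t) as Hy.
  assert (Hex : ex_derive ratio t) by (eexists; apply is_derive_ratio).
  split; apply @ex_derive_continuous; unfold peak1, peak2; auto_derive;
    repeat split; auto; nra.
Qed.

End ClosedForm.

(** Uniqueness comes from integrating rather than from a general theorem:
    [y * exp (- m t)] is constant along the flow, which with [P] fixes both
    momenta; [K] then fixes [E], so the right-hand sides of the position equations
    are those of the closed form. *)
Lemma flow_closed_form (T : Rbar) (q1 q2 p1 p2 : R -> R) :
  Rbar_lt 0 T -> flow T q1 q2 p1 p2 -> p1 0 < 0 < p2 0 ->
  exists a b y0 c1 c2,
    0 < a /\ 0 < b /\ 0 < y0 < 1 /\ exp (c2 - c1) = (a + b) ^ 2 * y0 /\
    forall t, time_interval T t ->
      q1 t = peak1 a b y0 c1 t /\ q2 t = peak2 a b y0 c2 t /\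
      p1 t = mom1 a b y0 t /\ p2 t = mom2 a b y0 t.
Proof.
  intros HT Hf Hsign.
  assert (I0 : time_interval T 0) by (split; [lra|exact HT]).
  set (P := p1 0 + p2 0). set (K := interaction q1 q2 p1 p2 0).
  assert (HK0 : K < 0).
  { pose proof (exp_gap_bounds _ _ (proj1 (Hf 0 I0))).
    unfold K, interaction. assert (p1 0 * p2 0 < 0) by nra. nra. }
  set (m := sqrt (P * P - 4 * K)).
  assert (Hmm : m * m = P * P - 4 * K) by (apply sqrt_sqrt; nra).
  assert (Hm : 0 < m) by (apply sqrt_lt_R0; nra).
  assert (HmP : - m < P < m) by (split; nra).
  assert (Hcons : forall t, time_interval T t ->
            p1 t + p2 t = P /\ p1 t * p2 t * (1 - exp (q2 t - q1 t)) = K).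
  { intros t Ht. split.
    - exact (momentum_conserved T _ _ _ _ Hf t Ht).
    - exact (interaction_conserved T _ _ _ _ Hf t Ht). }
  assert (Hprod : forall t, time_interval T t -> p1 t * p2 t < K).
  { intros t Ht. destruct (Hcons t Ht) as [_ HK].
    pose proof (exp_gap_bounds _ _ (proj1 (Hf t Ht))).
    assert (p1 t * p2 t < 0) by nra. nra. }
  assert (Hd : forall t, time_interval T t -> p1 t - p2 t < - m).
  { intros t Ht.
    (* [(p1 - p2)^2 = P^2 - 4 p1 p2 > P^2 - 4 K = m^2] *)
    assert (Hsq : forall s, time_interval T s -> m * m < (p1 s - p2 s) * (p1 s - p2 s)).
    { intros s Hs. pose proof (Hprod s Hs). destruct (Hcons s Hs) as [HP _].
      rewrite Hmm, <- HP. nra. }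
    assert (Hpos : 0 < p2 t - p1 t).
    { apply (positive_from_0 T (fun s => p2 s - p1 s)
        (fun s => - (p1 s * p2 s * exp (q2 s - q1 s)) - p1 s * p2 s * exp (q2 s - q1 s))).
      - intros s Hs. split.
        + apply (is_derive_minus p2 p1); apply Hf, Hs.
        + pose proof (Hsq s Hs). intros Heq. nra.
      - lra.
      - exact Ht. }
    pose proof (Hsq t Ht). nra. }
  set (y := fun t => (p1 t - p2 t + m) / (p1 t - p2 t - m)).
  set (y0 := y 0). set (a := m + P). set (b := m - P).
  assert (Hab : (a + b) / 2 = m) by (unfold a, b; field).
  assert (Hy0 : 0 < y0 < 1).
  { pose proof (Hd 0 I0). unfold y0, y.
    replace ((p1 0 - p2 0 + m) / (p1 0 - p2 0 - m))
      with ((- m - (p1 0 - p2 0)) / (m - (p1 0 - p2 0))) by (field; lra).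
    split; [apply Rdiv_lt_0_compat; lra|]. apply Rlt_div_l; lra. }
  assert (Hy : forall t, time_interval T t -> y t = ratio a b y0 t).
  { intros t Ht. unfold ratio. rewrite Hab.
    assert (Hc : y t * exp (- (m * t)) = y 0 * exp (- (m * 0))).
    { apply (constant_from_0 T (fun s => y s * exp (- (m * s)))); [|exact Ht].
      intros s Hs. pose proof (Hd s Hs) as Hds.
      destruct (Hf s Hs) as [_ [_ [_ [H3 H4]]]].
      destruct (Hcons s Hs) as [HP HK].
      unfold y. auto_derive.
      - repeat split; try (eexists; eassumption). lra.
      - apply is_derive_unique in H3; apply is_derive_unique in H4.
        change (Derive (fun x => p1 x) s) with (Derive p1 s).
        change (Derive (fun x => p2 x) s) with (Derive p2 s).
        rewrite H3, H4.
        (* conservation of [K] eliminates [E], leaving the Riccati equation for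
           [p1 - p2] *)
        assert (HE : p1 s * p2 s * exp (q2 s - q1 s) = p1 s * p2 s - K) by lra.
        rewrite HE.
        assert (HKm : K = (P * P - m * m) / 4) by lra.
        rewrite HKm, <- HP. field. lra. }
    rewrite Rmult_0_r, Ropp_0, exp_0, Rmult_1_r, exp_Ropp in Hc. fold y0 in Hc.
    rewrite <- Hc. field. apply Rgt_not_eq, exp_pos. }
  assert (Hp : forall t, time_interval T t ->
            ratio a b y0 t < 1 /\ p1 t = mom1 a b y0 t /\ p2 t = mom2 a b y0 t).
  { intros t Ht. unfold mom1, mom2. rewrite <- (Hy t Ht).
    pose proof (Hd t Ht). destruct (Hcons t Ht) as [HP _].
    assert (Hy1 : 1 - y t = - 2 * m / (p1 t - p2 t - m)) by (unfold y; field; lra).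
    assert (Hlt : y t < 1).
    { enough (0 < 1 - y t) by lra. rewrite Hy1.
      replace (- 2 * m / (p1 t - p2 t - m)) with (2 * m / (m - (p1 t - p2 t))) by (field; lra).
      apply Rdiv_lt_0_compat; lra. }
    split; [exact Hlt|].
    rewrite Hy1. unfold a, b, y. rewrite <- HP. split; field; lra. }
  set (c1 := q1 0 - ln (b + a * y0)). set (c2 := q2 0 + ln (a + b * y0)).
  assert (Ha : 0 < a) by (unfold a; lra). assert (Hb : 0 < b) by (unfold b; lra).
  assert (HE : forall t, time_interval T t ->
    exp (q2 t - q1 t) = (a + b) ^ 2 * ratio a b y0 t
       / ((a + b * ratio a b y0 t) * (b + a * ratio a b y0 t))).
  { intros t Ht. destruct (Hcons t Ht) as [_ HK]. destruct (Hp t Ht) as [Hlt [E1 E2]].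
    pose proof (ratio_pos a b y0 Hy0 t) as Hr.
    assert (0 < b * ratio a b y0 t) by nra. assert (0 < a * ratio a b y0 t) by nra.
    assert (HKab : K = - (a * b) / 4) by (unfold a, b; lra).
    assert (Hne : p1 t * p2 t <> 0) by (pose proof (Hprod t Ht); lra).
    assert (HEq : exp (q2 t - q1 t) = 1 - K / (p1 t * p2 t)) by (rewrite <- HK; field; nra).
    rewrite HEq, HKab, E1, E2. unfold mom1, mom2. field. lra. }
  assert (R0 : ratio a b y0 0 = y0) by (unfold ratio; rewrite Rmult_0_r, exp_0; ring).
  assert (N1 : 0 < a + b * y0) by nra. assert (N2 : 0 < b + a * y0) by nra.
  assert (Hgap : exp (c2 - c1) = (a + b) ^ 2 * y0).
  { unfold c1, c2.
    replace (q2 0 + ln (a + b * y0) - (q1 0 - ln (b + a * y0)))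
      with ((q2 0 - q1 0) + ln (a + b * y0) + ln (b + a * y0)) by ring.
    rewrite !exp_plus, !exp_ln, (HE 0 I0), R0 by assumption. field. lra. }
  exists a, b, y0, c1, c2. repeat (split; [assumption|]).
  intros t Ht. destruct (Hp t Ht) as [_ [E1 E2]].
  assert (Hdiff : forall s, time_interval T s ->
     is_derive (fun r => q1 r - peak1 a b y0 c1 r) s 0 /\
     is_derive (fun r => q2 r - peak2 a b y0 c2 r) s 0).
  { intros s Hs. destruct (Hp s Hs) as [Hlt [F1 F2]].
    apply ratio_lt_1 in Hlt; try assumption.
    destruct (closed_form_flow a b y0 c1 c2 Ha Hb Hy0 Hgap s) as [_ [G1 [G2 _]]].
    { split; [apply Hs|exact Hlt]. }
    destruct (Hf s Hs) as [_ [H1 [H2 _]]].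
    rewrite exp_peak_gap in G1, G2 by assumption.
    rewrite (HE s Hs), F1, F2 in H1, H2.
    split.
    - pose proof (is_derive_minus _ _ _ _ _ H1 G1) as HD.
      rewrite minus_eq_zero in HD. exact HD.
    - pose proof (is_derive_minus _ _ _ _ _ H2 G2) as HD.
      rewrite minus_eq_zero in HD. exact HD. }
  assert (D1 : q1 t - peak1 a b y0 c1 t = q1 0 - peak1 a b y0 c1 0).
  { apply (constant_from_0 T (fun r => q1 r - peak1 a b y0 c1 r)); [apply Hdiff|exact Ht]. }
  assert (D2 : q2 t - peak2 a b y0 c2 t = q2 0 - peak2 a b y0 c2 0).
  { apply (constant_from_0 T (fun r => q2 r - peak2 a b y0 c2 r)); [apply Hdiff|exact Ht]. }
  unfold peak1 at 2 in D1. unfold peak2 at 2 in D2. rewrite R0 in D1, D2.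
  unfold c1 at 2 in D1. unfold c2 at 2 in D2.
  repeat split; [lra|lra|exact E1|exact E2].
Qed.

(** The closed form is a solution up to the collision time and extends the given
    one, so maximality forces [T] to be at least that time. *)
Lemma collision (T : Rbar) (q p : R -> R * R) :
  is_maximal_solution T q p -> fst (p 0) < 0 < snd (p 0) ->
  collides_in_finite_time T q.
Proof.
  intros [Hsol Hmax] Hsign. pose proof (proj1 Hsol) as HT.
  destruct (flow_of_solution T q p Hsol) as [q1 [q2 [p1 [p2 [Hf Heq]]]]].
  rewrite (proj2 (Heq 0 (Rle_refl 0))) in Hsign. simpl in Hsign.
  destruct (flow_closed_form T q1 q2 p1 p2 HT Hf Hsign)
    as [a [b [y0 [c1 [c2 [Ha [Hb [Hy0 [Hgap Hform]]]]]]]]].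
  set (t := collision_time a b y0).
  assert (Ht : 0 < t) by (apply collision_time_pos; assumption).
  assert (Hform' : forall s, time_interval T s ->
    q s = (peak1 a b y0 c1 s, peak2 a b y0 c2 s) /\ p s = (mom1 a b y0 s, mom2 a b y0 s)).
  { intros s Hs. destruct (Heq s (proj1 Hs)) as [-> ->].
    destruct (Hform s Hs) as [-> [-> [-> ->]]]. split; reflexivity. }
  assert (HtT : Rbar_le t T).
  { apply (Hmax t (fun s => (peak1 a b y0 c1 s, peak2 a b y0 c2 s))
                  (fun s => (mom1 a b y0 s, mom2 a b y0 s))).
    - apply solution_of_flow; [exact Ht|]. apply closed_form_flow; assumption.
    - intros s Hs. destruct (Hform' s Hs). split; symmetry; assumption. }
  exists t. split; [exact Ht|]. split; [exact HtT|].
  exists (peak1 a b y0 c1 t, peak2 a b y0 c2 t).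
  split; [|apply peaks_meet; assumption].
  apply (filterlim_ext_loc (fun s => (peak1 a b y0 c1 s, peak2 a b y0 c2 s))).
  - unfold at_left, within. apply (filter_imp (fun s => 0 < s)); [|apply open_gt, Ht].
    intros s Hs Hst. symmetry. apply Hform'. split; [lra|].
    apply (Rbar_lt_le_trans s t T); assumption.
  - apply (filterlim_filter_le_1 (F := locally t)); [apply filter_le_within|].
    destruct (peaks_continuous a b y0 c1 c2 Ha Hb Hy0 t) as [C1 C2].
    apply filterlim_locally. intros eps.
    apply filter_and.
    + exact (proj1 (filterlim_locally _ _) C1 eps).
    + exact (proj1 (filterlim_locally _ _) C2 eps).
Qed.

Theorem theorem3p1 (u : R -> R -> R) (q p : R -> R * R) (T : Rbar) :
  is_twopeakon T q p u ->
  Omega (q 0) ->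
  (collides_in_finite_time T q <-> snd (p 0) > 0 /\ 0 > fst (p 0)).
Proof.
  intros [Hmax _] _. split.
  - intros Hcol.
    destruct (flow_of_solution T q p (proj1 Hmax)) as [q1 [q2 [p1 [p2 [Hf Heq]]]]].
    rewrite (proj2 (Heq 0 (Rle_refl 0))). simpl.
    destruct (Rlt_dec 0 (p2 0)); [destruct (Rlt_dec (p1 0) 0); [split; lra|]|];
      exfalso; apply (no_collision T q1 q2 p1 p2 q Hf);
      try (intros; apply Heq; assumption); try exact Hcol; lra.
  - intros [H2 H1]. apply (collision T q p Hmax). lra.
Qed.
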